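(* Let $b\geq 1$ and $l\geq 2$ be two integers, and let $G$ be a connected graph of order $n$ with $$n\geq\max\left\{\left(\tfrac{5}{2}b^{2}+4b+3\right)l-b^{2}-2b-5,\ \frac{(2b+1)l^{2}+(2b-3)l+2}{2}\right\}.$$ If $$q(G)\geq q\big(K_{bl-1}\vee(K_{n-(b+1)l+2}\cup(l-1)K_1)\big),$$ then $t_{l}(G)\geq b$, unless $G=K_{bl-1}\vee(K_{n-(b+1)l+2}\cup(l-1)K_1)$.
   Context: All graphs are finite, undirected and simple; equality of graphs means isomorphism. The order of a graph is its number of vertices. $K_m$ is the complete graph on $m$ vertices, $G_1\cup G_2$ is the disjoint union of graphs, $tG_1$ is the disjoint union of $t$ copies of $G_1$, and the join $G_1\vee G_2$ is obtained from $G_1\cup G_2$ by adding all edges between $V(G_1)$ and $V(G_2)$. The signless Laplacian matrix of $G$ is $Q(G)=D(G)+A(G)$, where $A(G)$ is the adjacency matrix and $D(G)$ is the diagonal matrix of vertex degrees. The $Q$-index $q(G)$ is the largest eigenvalue of $Q(G)$. Let $c(H)$ denote the number of connected components of a graph $H$ and $\alpha(G)$ the independence number of $G$. For an integer $l\geq2$, the $l$-toughness of $G$ is $$t_l(G)=\min\left\{\frac{|S|}{c(G-S)}:S\subset V(G),\ c(G-S)\geq l\right\}\quad\text{if } 2\leq l\leq\alpha(G),$$ and $t_l(G)=+\infty$ if $l>\alpha(G)$. Here $G-S$ is the subgraph of $G$ induced by $V(G)\setminus S$. *)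

(* Defs.v *)
From HB Require Import structures.
From mathcomp Require Import all_boot all_order all_algebra.
From mathcomp Require Import classical_sets reals constructive_ereal.

Set Implicit Arguments.
Unset Strict Implicit.
Unset Printing Implicit Defensive.

Import Order.TTheory GRing.Theory Num.Theory.

Local Open Scope ring_scope.

Record sgraph := SGraph {
  vertex :> finType;
  adj : rel vertex;
  adj_sym : symmetric adj;
  adj_irr : irreflexive adj }.

Definition graph_isomorphic (G H : sgraph) : Prop :=
  exists2 f : G -> H, bijective f & forall x y, adj (f x) (f y) = adj x y.

Definition graph_connected (G : sgraph) : Prop :=
  (0 < #|G|)%N /\ forall x y : G, connect (@adj G) x y.

Section Constructions.

Definition complete_adj (m : nat) : rel 'I_m := fun x y => x != y.

Lemma complete_sym m : symmetric (@complete_adj m).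
Proof. by move=> x y; rewrite /complete_adj eq_sym. Qed.

Lemma complete_irr m : irreflexive (@complete_adj m).
Proof. by move=> x; rewrite /complete_adj eqxx. Qed.

Definition complete_graph (m : nat) : sgraph :=
  SGraph (@complete_sym m) (@complete_irr m).

Definition union_adj (G H : sgraph) : rel (G + H)%type := fun u v =>
  match u, v with
  | inl x, inl y => adj x y
  | inr x, inr y => adj x y
  | _, _ => false
  end.

Lemma union_sym G H : symmetric (@union_adj G H).
Proof. by move=> [x|x] [y|y] //=; rewrite adj_sym. Qed.

Lemma union_irr G H : irreflexive (@union_adj G H).
Proof. by move=> [x|x] /=; rewrite adj_irr. Qed.

Definition graph_union (G H : sgraph) : sgraph :=
  SGraph (@union_sym G H) (@union_irr G H).

Definition join_adj (G H : sgraph) : rel (G + H)%type := fun u v =>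
  match u, v with
  | inl x, inl y => adj x y
  | inr x, inr y => adj x y
  | _, _ => true
  end.

Lemma join_sym G H : symmetric (@join_adj G H).
Proof. by move=> [x|x] [y|y] //=; rewrite adj_sym. Qed.

Lemma join_irr G H : irreflexive (@join_adj G H).
Proof. by move=> [x|x] /=; rewrite adj_irr. Qed.

Definition graph_join (G H : sgraph) : sgraph :=
  SGraph (@join_sym G H) (@join_irr G H).

Definition copies_adj (t : nat) (G : sgraph) : rel ('I_t * G)%type :=
  fun u v => (u.1 == v.1) && adj u.2 v.2.

Lemma copies_sym t G : symmetric (@copies_adj t G).
Proof. by move=> u v; rewrite /copies_adj eq_sym adj_sym. Qed.

Lemma copies_irr t G : irreflexive (@copies_adj t G).
Proof. by move=> u; rewrite /copies_adj adj_irr andbF. Qed.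

Definition graph_copies (t : nat) (G : sgraph) : sgraph :=
  SGraph (@copies_sym t G) (@copies_irr t G).

End Constructions.

Section SignlessLaplacian.

Variables (R : realType) (G : sgraph).

Definition degree (x : G) : nat := #|[set y | adj x y]|.

Definition adjacency_mx : 'M[R]_#|G| :=
  \matrix_(i, j) (adj (enum_val i) (enum_val j))%:R.

Definition degree_mx : 'M[R]_#|G| :=
  diag_mx (\row_i (degree (enum_val i))%:R).

Definition signless_laplacian : 'M[R]_#|G| := degree_mx + adjacency_mx.

(* The spectrum is finite, and nonempty when G has a vertex (the matrix is
   symmetric), so this supremum is a maximum. *)
Definition Qindex : R :=
  sup [set a : R | eigenvalue signless_laplacian a]%classic.

End SignlessLaplacian.

Section Toughness.

Variable G : sgraph.

Definition independent_set (A : {set G}) : bool :=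
  [forall x in A, forall y in A, ~~ adj x y].

Definition independence_number : nat :=
  \max_(A : {set G} | independent_set A) #|A|.

(* The components of G - S are the classes, among the vertices outside S, of
   the connectivity relation of the edges with both ends outside S. *)
Definition delete_adj (S : {set G}) : rel G :=
  [rel x y | [&& x \notin S, y \notin S & adj x y]].

Definition ncomp_delete (S : {set G}) : nat := n_comp (delete_adj S) (~: S).

Definition toughness (R : realType) (l : nat) : \bar R :=
  (if (l <= independence_number)%N then
    \big[Order.min/+oo]_(S : {set G} | (l <= ncomp_delete S)%N)
      (#|S|%:R / (ncomp_delete S)%:R)%:E
  else +oo)%E.

End Toughness.

Definition extremal_graph (b l n : nat) : sgraph :=
  graph_join (complete_graph (b * l - 1))
    (graph_union (complete_graph (n - (b + 1) * l + 2))
                 (graph_copies (l - 1) (complete_graph 1))).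

(* Main.v *)
(* Suppose a set S has c >= l components in G - S and |S| < b c. Weighting the
   vertices by their degrees bounds q(G) by n - 2 + 2m/(n - 1), where m is the
   number of edges, while q of the extremal graph exceeds 2(n - l), read off its
   3 x 3 equitable quotient. So G misses fewer than (n - 1)(l - 1) edges, and for
   n as large as assumed this forces c = l with all components but one being
   single vertices. Then G is a spanning subgraph of the extremal graph, and
   comparing with the positive eigenvector of the latter shows that
   q(G) >= q of the extremal graph is only possible when G is that graph. *)
Require Import Defs.
From mathcomp Require Import all_boot all_order all_algebra.
From mathcomp Require Import classical_sets reals constructive_ereal.
From mathcomp Require Import ring lra zify.
From mathcomp Require boolp polyrcf.

Import fintype boot.finset.
Import Order.TTheory GRing.Theory Num.Theory.

Local Open Scope ring_scope.

(** * Eigenfunctions on the vertices and the Q-index *)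

Section Spectral.
Variables (R : realType) (G : sgraph).
Implicit Types (a t : R) (x w : G -> R) (u v : G).

Lemma degree_sum v : (degree v)%:R = \sum_(u | adj v u) 1 :> R.
Proof. by rewrite /degree -sum1_card natr_sum; apply: eq_bigl => u; rewrite inE. Qed.

Lemma sum_adjD (f g : G -> R) v :
  \sum_(u | adj v u) (f v + g u) = (degree v)%:R * f v + \sum_(u | adj v u) g u.
Proof.
by rewrite big_split /= degree_sum mulr_suml; congr (_ + _); apply: eq_bigr => u _; rewrite mul1r.
Qed.

Lemma mul_signless_laplacian (r : 'rV[R]_#|G|) j :
  (r *m signless_laplacian R G) 0 j =
  \sum_(u | adj (enum_val j) u) (r 0 j + r 0 (enum_rank u)).
Proof.
have -> : \sum_(u | adj (enum_val j) u) (r 0 j + r 0 (enum_rank u)) =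
  \sum_(u | adj (enum_val j) u)
    ((fun v : G => r 0 (enum_rank v)) (enum_val j) + r 0 (enum_rank u)).
  by apply: eq_bigr => u _; rewrite enum_valK.
rewrite (sum_adjD (fun v : G => r 0 (enum_rank v)) (fun v : G => r 0 (enum_rank v))).
rewrite enum_valK /signless_laplacian mulmxDr mxE; congr (_ + _).
  by rewrite /degree_mx mul_mx_diag !mxE mulrC.
rewrite mxE (reindex _ (onW_bij _ (@enum_rank_bij G))) /= [RHS]big_mkcond /=.
apply: eq_bigr => u _; rewrite mxE enum_rankK adj_sym.
by case: adj; rewrite ?mulr1 ?mulr0.
Qed.

(** Degree and adjacency terms merge into one sum over the edges at [v], so all later estimates
    handle functions on vertices instead of matrices. *)
Lemma eigenvalue_eigenfunction a :
  eigenvalue (signless_laplacian R G) a <->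
  exists2 x, exists v, x v != 0 &
    forall v, \sum_(u | adj v u) (x v + x u) = a * x v.
Proof.
split=> [/eigenvalueP[r rE r0] | [x [v xv0] xE]].
  exists (fun v => r 0 (enum_rank v)).
    by have /rV0Pn[j rj] := r0; exists (enum_val j); rewrite enum_valK.
  move=> v; have /rowP/(_ (enum_rank v)) := rE.
  by rewrite mul_signless_laplacian mxE enum_rankK.
apply/eigenvalueP; exists (\row_j x (enum_val j)); last first.
  by apply/rV0Pn; exists (enum_rank v); rewrite mxE enum_rankK.
apply/rowP => j; rewrite mul_signless_laplacian !mxE -xE.
by apply: eq_bigr => u _; rewrite mxE enum_rankK.
Qed.

Lemma eigenfunction_max_ratio {x w} :
  (forall v, 0 < w v) -> (exists v, x v != 0) ->
  exists2 t, 0 < t &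
    (forall v, `|x v| <= t * w v) /\ exists v, `|x v| = t * w v.
Proof.
move=> w0 [v0 xv0].
have [m _ mP] : exists2 m : G, true & forall v, `|x v| / w v <= `|x m| / w m.
  by case: (Order.TotalTheory.arg_maxP (fun v : G => `|x v| / w v) (i0 := v0) (P := predT) isT)
    => m _ h; exists m => // v; apply: h.
exists (`|x m| / w m).
  by apply: lt_le_trans (mP v0); rewrite divr_gt0 ?normr_gt0.
split; last by exists m; rewrite divfK // gt_eqF.
by move=> v; rewrite -ler_pdivrMr.
Qed.

(* The Collatz-Wielandt argument at a vertex maximizing |x| / w: there the
   eigenvalue equation forces equality in the chain of estimates whenever [a]
   is not smaller than the weighted row-sum bound [t]. *)
Lemma collatz_wielandt {a t w} : (forall v, 0 < w v) ->
  (forall v, \sum_(u | adj v u) (w v + w u) <= t * w v) ->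
  eigenvalue (signless_laplacian R G) a ->
  a <= t /\ (a = t -> graph_connected G ->
             forall v, \sum_(u | adj v u) (w v + w u) = t * w v).
Proof.
move=> w0 wt /eigenvalue_eigenfunction[x xn0 xE].
have [s s0 [xs [m xm]]] := eigenfunction_max_ratio w0 xn0.
have key v : `|x v| = s * w v ->
   a * (s * w v) <= \sum_(u | adj v u) (`|x v| + `|x u|)
   <= s * \sum_(u | adj v u) (w v + w u).
  move=> xv; apply/andP; split.
    rewrite -xv; apply: le_trans (_ : `|a * x v| <= _).
      by rewrite normrM ler_wpM2r // ler_norm.
    rewrite -xE; apply: le_trans (ler_norm_sum _ _ _) _.
    by apply: ler_sum => u _; apply: ler_normD.
  by rewrite mulr_sumr; apply: ler_sum => u _; rewrite mulrDr lerD.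
split.
  have /andP[h1 h2] := key m xm.
  have h3 : s * \sum_(u | adj m u) (w m + w u) <= s * (t * w m).
    by rewrite ler_pM2l.
  have := le_trans h1 (le_trans h2 h3).
  by rewrite mulrCA ler_pM2l // ler_pM2r.
move=> eat [_ conn].
(* Equality at a maximizing vertex makes all its neighbours maximizing, so by connectedness every
   vertex is. *)
have step v : `|x v| = s * w v ->
    \sum_(u | adj v u) (w v + w u) = t * w v /\
    forall u, adj v u -> `|x u| = s * w u.
  move=> xv; have /andP[h1 h2] := key v xv; split.
    apply/eqP; rewrite eq_le wt /=.
    by have := le_trans h1 h2; rewrite eat mulrCA ler_pM2l.
  have h3 : s * \sum_(u | adj v u) (w v + w u) <= s * (t * w v) by rewrite ler_pM2l.
  have : \sum_(u | adj v u) (s * (w v + w u) - (`|x v| + `|x u|)) = 0.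
    rewrite sumrB -mulr_sumr; apply/eqP; rewrite subr_eq0 eq_le h2 andbT.
    by apply: le_trans h3 _; rewrite mulrCA -eat.
  move/eqP; rewrite psumr_eq0 => [/allP h u vu|u _]; last first.
    by rewrite subr_ge0 mulrDr lerD.
  have := h u (mem_index_enum u); rewrite vu /= subr_eq0 mulrDr xv => /eqP/addrI.
  by move=> ->.
have all_max v : `|x v| = s * w v.
  have /connectP[p pp ->] := conn m v.
  elim: p m xm pp => //= u p IH y yx /andP[yu pu].
  by apply: IH pu; apply: (step y yx).2.
by move=> v; apply: (step v (all_max v)).1.
Qed.

Lemma eigenvalue_has_ubound :
  has_ubound [set a : R | eigenvalue (signless_laplacian R G) a]%classic.
Proof.
exists (\sum_(u : G) 2) => a /= /(collatz_wielandt (w := fun=> 1) (t := \sum_(u : G) 2)).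
case=> // v; rewrite mulr1 [leLHS]big_mkcond /=.
by apply: ler_sum => u _; case: ifP.
Qed.

Lemma eigenvalue_le_Qindex {a} :
  eigenvalue (signless_laplacian R G) a -> a <= Qindex R G.
Proof. by move=> ha; apply: ub_le_sup ha; exact: eigenvalue_has_ubound. Qed.

(* Positivity only excludes the junk value 0 of the supremum. The supremum is
   a root of the characteristic polynomial by continuity. *)
Lemma Qindex_eigenvalue :
  0 < Qindex R G -> eigenvalue (signless_laplacian R G) (Qindex R G).
Proof.
move=> q0; rewrite eigenvalue_root_char; apply: contraT => nroot.
set p := char_poly _ in nroot.
have p0 : 0 < `|p.[Qindex R G]| by rewrite normr_gt0.
have [d d0 dP] := polyrcf.poly_cont (Qindex R G) p p0.
have hsup : has_sup [set a : R | eigenvalue (signless_laplacian R G) a]%classic.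
  have [//|nsup] := boolp.pselect (has_sup
    [set a : R | eigenvalue (signless_laplacian R G) a]%classic).
  move: q0.
  by rewrite /Qindex sup_out // ltxx.
have [e /= ev elt] := sup_adherent d0 hsup.
have := dP e; rewrite ltr_distl.
have := eigenvalue_le_Qindex ev; move: ev; rewrite eigenvalue_root_char.
move=> /rootP -> le_e; rewrite -/(Qindex R G) in elt.
by rewrite sub0r normrN ltxx elt /= (le_lt_trans le_e) ?ltrDl // => /(_ isT).
Qed.

End Spectral.

(** * Degree bounds on eigenvalues and comparison with a spanning supergraph *)

Lemma connected_degree_gt0 (G : sgraph) (v : G) :
  graph_connected G -> (1 < #|G|)%N -> (0 < degree v)%N.
Proof.
move=> [_ conn]; rewrite ltnNge => /negP n1; rewrite lt0n; apply/negP => /eqP d0.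
apply: n1; suff all_v u : u = v.
  by apply/fintype_le1P => u u'; rewrite (all_v u) (all_v u').
have /connectP[[|w p] /=] := conn v u; first by [].
move=> /andP[vw _]; have : w \in [set y | adj v y] by rewrite inE.
by move/eqP: d0; rewrite cards_eq0 => /eqP ->; rewrite inE.
Qed.

Lemma degree_lt_card (G : sgraph) (v : G) : (degree v < #|G|)%N.
Proof.
have sub : [set u | adj v u] \subset [set~ v].
  by apply/subsetP => u; rewrite !inE; apply: contraTneq => ->; rewrite adj_irr.
apply: leq_ltn_trans (subset_leq_card sub) _.
by rewrite cardsC1 ltn_predL; apply/card_gt0P; exists v.
Qed.

(** Outside its neighbourhood, [v] contributes d(v) and each of the n - 1 - d(v) other vertices at
    least 1, together at least n - 1. *)
Lemma neighbor_degree_sum_le (G : sgraph) (v : G) : (forall u : G, 0 < degree u)%N ->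
  (\sum_(u : G | adj v u) degree u + (#|G| - 1) <= \sum_(u : G) degree u)%N.
Proof.
move=> d0; rewrite (bigID (adj v) predT) /= leq_add2l.
have card_split : (#|G| - 1 = degree v + \sum_(u : G | ~~ adj v u && (u != v)) 1)%N.
  rewrite -sum1_card (bigID (adj v)) /= [X in (_ + X)%N](bigD1 v) ?adj_irr //=.
  by rewrite addnCA add1n subn1 /= /degree -sum1dep_card.
by rewrite card_split [leqRHS](bigD1 v) ?adj_irr //= leq_add2l; apply: leq_sum => u _; rewrite d0.
Qed.

(* Collatz-Wielandt with the degrees as weights bounds an eigenvalue by
   max (d(v) + average degree of the neighbours of v). *)
Lemma eigenvalue_le_degree_sum (R : realType) (G : sgraph) (a : R) :
  graph_connected G -> (1 < #|G|)%N -> eigenvalue (signless_laplacian R G) a ->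
  a <= (\sum_(v : G) degree v)%:R / (#|G|%:R - 1) + #|G|%:R - 2.
Proof.
move=> conn n1; have d0 v := connected_degree_gt0 G v conn n1.
have n0 : 0 < #|G|%:R - 1 :> R by rewrite subr_gt0 ltr1n.
move=> /(@collatz_wielandt R G a _ (fun v => (degree v)%:R)).
case/(_ ((\sum_(v : G) degree v)%:R / (#|G|%:R - 1) + #|G|%:R - 2)) => //.
  by move=> v; rewrite ltr0n.
move=> v; rewrite (sum_adjD _ _ (fun v => (degree v)%:R) (fun v => (degree v)%:R)).
have := neighbor_degree_sum_le G v d0.
have : (\sum_(u | adj v u) degree u <= degree v * (#|G| - 1))%N.
  rewrite /degree -sum_nat_const big_set; apply: leq_sum => u _.
  by have := degree_lt_card G u; rewrite /degree; lia.
have := degree_lt_card G v; have := d0 v; rewrite -natr_sum.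
move: (\sum_(u | _) _)%N (\sum_(u : G) _)%N (degree v) (#|G|) n0 n1 => T D d n n0 n1.
move=> h1 h2 h3 h4; have eN : (n - 1)%:R = n%:R - 1 :> R by rewrite natrB // ltnW.
have {}h2 : d%:R <= n%:R - 1 :> R by rewrite -eN ler_nat; lia.
have {}h3 : T%:R <= d%:R * (n%:R - 1) :> R by rewrite -eN -natrM ler_nat.
have {}h4 : T%:R + (n%:R - 1) <= D%:R :> R by rewrite -eN -natrD ler_nat.
have {}h1 : 0 < d%:R :> R by rewrite ltr0n.
rewrite -(ler_pM2l n0).
have -> : (n%:R - 1) * ((D%:R / (n%:R - 1) + n%:R - 2) * d%:R) =
   (D%:R + (n%:R - 1) * (n%:R - 2)) * d%:R :> R.
  by field; rewrite gt_eqF.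
have -> : n%:R - 2 = n%:R - 1 - 1 :> R by ring.
move: (d%:R : R) (T%:R : R) (D%:R : R) (n%:R - 1) h1 h2 h3 h4 n0 => d' T' D' N h1 h2 h3 h4 n0.
(* With N = n - 1, the slack multiplied by N is the sum of these two nonnegative products. *)
have h5 : 0 <= (D' - T' - N) * d' by rewrite mulr_ge0 //; lra.
have h6 : 0 <= (d' * N - T') * (N - d') by rewrite mulr_ge0 //; lra.
rewrite -subr_ge0; have -> : (D' + N * (N - 1)) * d' - N * (d' * d' + T') =
  (D' - T' - N) * d' + (d' * N - T') * (N - d') by ring.
exact: addr_ge0.
Qed.

(** Pulled back along [f], the positive eigenfunction of [H] loses the terms of the edges missing in
    [G]. These terms are positive, so equality leaves no missing edge. *)
Lemma spanning_subgraph_eigenvalue (R : realType) (G H : sgraph) (f : G -> H)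
    (w : H -> R) (r a : R) :
  bijective f -> (forall x y, adj x y -> adj (f x) (f y)) ->
  (forall v, 0 < w v) ->
  (forall v, \sum_(u | adj v u) (w v + w u) = r * w v) ->
  eigenvalue (signless_laplacian R G) a ->
  a <= r /\ (a = r -> graph_connected G -> graph_isomorphic G H).
Proof.
move=> fbij fhom w0 wr ev.
have sumH v : r * w (f v) = \sum_(u | adj v u) (w (f v) + w (f u)) +
     \sum_(u | adj (f v) (f u) && ~~ adj v u) (w (f v) + w (f u)).
  rewrite -wr (reindex f) /=; last exact: onW_bij.
  rewrite (bigID (adj v)) /=; congr (_ + _); apply: eq_bigl => u.
  by case h : (adj v u); rewrite ?andbF // (fhom _ _ h).
have pos v u : 0 < w (f v) + w (f u) by rewrite addr_gt0.
have wle v : \sum_(u | adj v u) (w (f v) + w (f u)) <= r * w (f v).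
  by rewrite sumH lerDl sumr_ge0 // => u _; rewrite ltW.
have [ar eq_ar] := collatz_wielandt R G (w := fun v => w (f v)) (fun v => w0 (f v)) wle ev.
split=> // ear conn; exists f => // x y; apply/idP/idP => [|/fhom //].
have /eqP := eq_ar ear conn x; rewrite sumH -subr_eq0 opprD addrA subrr sub0r oppr_eq0.
rewrite psumr_eq0 => [/allP/(_ y (mem_index_enum y))|u _]; last exact: ltW.
move=> + fxy; rewrite fxy /=; case: (adj x y) => //= /eqP s0.
by have := pos x y; rewrite s0 ltxx.
Qed.

(** * The positive eigenfunction of the extremal graph *)

(** The equation is the characteristic equation of the equitable quotient with classes K_s, K_k and
    t K_1. The root comes from a sign change between 2(s + k - 1) and 2(s + k + t - 1), the
    Q-indices of complete graphs of orders s + k and s + k + t. *)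
Lemma join_char_root (R : rcfType) (s k t : R) : 1 <= s -> 1 <= k -> 0 < t ->
  exists2 r : R, 2 * (s + k - 1) < r &
    (r - (s + 2 * k - 2)) * (r - s) * (r - (2 * s + k + t - 2))
    = k * s * (r - s) + t * s * (r - (s + 2 * k - 2)).
Proof.
move=> s1 k1 t0.
pose p : {poly R} := ('X - (s + 2 * k - 2)%:P) * ('X - s%:P) * ('X - (2 * s + k + t - 2)%:P)
  - (k * s)%:P * ('X - s%:P) - (t * s)%:P * ('X - (s + 2 * k - 2)%:P).
have pE x : p.[x] = (x - (s + 2 * k - 2)) * (x - s) * (x - (2 * s + k + t - 2))
    - k * s * (x - s) - t * s * (x - (s + 2 * k - 2)) by rewrite /p !hornerE.
have lo : p.[2 * (s + k - 1)] < 0.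
  have -> : p.[2 * (s + k - 1)] = - (t * s * (s + (s + 2 * (k - 1)))) by rewrite pE; ring.
  by rewrite oppr_lt0 !mulr_gt0 //; lra.
have hi : 0 <= p.[2 * (s + k + t - 1)].
  have -> : p.[2 * (s + k + t - 1)] = 2 * (k + t - 1) * t * (s + 2 * k + 2 * t)
      + 2 * s * t * k by rewrite pE; ring.
  by rewrite addr_ge0 ?mulr_ge0 //; lra.
have [||r /andP[r1 r2] /rootP pr] := @poly_ivt R p (2 * (s + k - 1)) (2 * (s + k + t - 1)).
- by lra.
- by rewrite (ltW lo).
exists r; last by move: pr; rewrite pE; lra.
by rewrite lt_neqAle r1 andbT; apply: contraTneq lo => ->; rewrite pr ltxx.
Qed.

Notation clique_star s k t :=
  (graph_join (complete_graph s)
     (graph_union (complete_graph k) (graph_copies t (complete_graph 1)))).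

Lemma clique_star_eigenfunction (R : realType) (s k t : nat) :
  (0 < s)%N -> (0 < k)%N -> (0 < t)%N ->
  exists2 r : R, 2 * (s%:R + k%:R - 1) < r &
  exists2 w : clique_star s k t -> R, forall v, 0 < w v &
    forall v, \sum_(u | adj v u) (w v + w u) = r * w v.
Proof.
move=> s0 k0 t0.
have s1 : 1 <= s%:R :> R by rewrite ler1n.
have k1 : 1 <= k%:R :> R by rewrite ler1n.
have t1 : 0 < t%:R :> R by rewrite ltr0n.
have [r r_gt rE] := join_char_root R _ _ _ s1 k1 t1; exists r => //.
have rs : 0 < r - s%:R by lra.
have rk : 0 < r - (s%:R + 2 * k%:R - 2) by lra.
(* Normalized to 1 on K_s; the eigenvalue equations at the other two classes then determine their
   values, positive by the lower bound on [r]. *)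
pose w (v : clique_star s k t) : R := match v with
  | inl _ => 1
  | inr (inl _) => s%:R / (r - (s%:R + 2 * k%:R - 2))
  | inr (inr _) => s%:R / (r - s%:R) end.
have sum_complete m (i : 'I_m) (c : R) :
  \sum_(j | complete_adj i j) c = (m%:R - 1) * c.
  rewrite [RHS]mulrBl mul1r -[m in RHS]card_ord mulr_natl -sumr_const [in RHS](bigD1 i) //=.
  by rewrite addrC addrK; apply: eq_bigl => j; rewrite /complete_adj eq_sym.
exists w; first by case=> [?|[?|?]] /=; rewrite ?ltr01 ?divr_gt0 //; lra.
case=> [i|[i|[i e]]]; rewrite !big_sumType /=.
- rewrite sum_complete !sumr_const card_prod !card_ord muln1.
  rewrite -(mulr_natl _ k) -(mulr_natl _ t).
  set y := s%:R / _; set z := s%:R / (r - s%:R).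
  (* The equation at K_s is the cubic divided by its two positive factors. *)
  have ksum : r - (2 * s%:R + k%:R + t%:R - 2) = k%:R * y + t%:R * z.
    have PQ0 : (r - (s%:R + 2 * k%:R - 2)) * (r - s%:R) != 0 by rewrite gt_eqF ?mulr_gt0.
    apply: (mulfI PQ0); rewrite rE /y /z; field.
    by rewrite !gt_eqF.
  by rewrite mulr1 !mulrDr !mulr1; lra.
- rewrite sum_complete big_pred0_eq addr0 sumr_const card_ord -(mulr_natl _ s).
  by field; rewrite gt_eqF.
- rewrite big_pred0_eq add0r sumr_const card_ord -(mulr_natl _ s).
  rewrite big_pred0 => [|[j e']]; last first.
    by rewrite /copies_adj /= !ord1 complete_irr andbF.
  by field; rewrite gt_eqF.
Qed.

(** * Components of G - S and missing edges *)

Section Components.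
Variables (G : sgraph) (S : {set G}).
Implicit Types (u v r : G).

(** Components are indexed by their canonical representatives. Vertices of [S] are isolated for
    [delete_adj S], hence roots themselves, and have to be excluded. *)
Definition component_roots : {set G} :=
  [set r | (r \notin S) && roots (delete_adj S) r].
Definition component r : {set G} :=
  [set v | (v \notin S) && (fingraph.root (delete_adj S) v == r)].

Lemma delete_connect_sym : connect_sym (delete_adj S).
Proof.
apply: sym_connect_sym => u v; rewrite /delete_adj /= adj_sym.
by rewrite andbA [(u \notin S) && _]andbC -andbA.
Qed.

Lemma delete_connect_notin u v : connect (delete_adj S) u v -> (u \in S) = (v \in S).
Proof.
move=> uv; apply: (closed_connect _ uv) => x y.
by rewrite /delete_adj /= => /and3P[/negPf -> /negPf -> _].
Qed.

Lemma ncomp_delete_card : ncomp_delete S = #|component_roots|.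
Proof. by apply: eq_card => r; rewrite !inE andbC. Qed.

Lemma root_component_roots v : v \notin S ->
  fingraph.root (delete_adj S) v \in component_roots.
Proof.
move=> vS; rewrite inE roots_root ?andbT; last exact: delete_connect_sym.
by rewrite -(delete_connect_notin v) // connect_root.
Qed.

Lemma root_mem_component r : r \in component_roots -> r \in component r.
Proof. by rewrite !inE => /andP[-> /=]. Qed.

Lemma sum_components (R : nmodType) (F : G -> R) :
  (\sum_(v | v \notin S) F (fingraph.root (delete_adj S) v) =
  \sum_(r in component_roots) F r *+ #|component r|)%R.
Proof.
rewrite (partition_big (fingraph.root (delete_adj S)) (mem component_roots)) /=; last first.
  exact: root_component_roots.
apply: eq_bigr => r _; rewrite -sumr_const; apply: eq_big => [v|v /andP[_ /eqP ->] //].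
by rewrite inE.
Qed.

Lemma sum_card_components : (\sum_(r in component_roots) #|component r| = #|~: S|)%N.
Proof.
have := sum_components nat (fun=> 1%N); rewrite -[LHS]/(\sum_(v | v \notin S) 1)%N.
rewrite sum1_card => h; rewrite -[RHS](eq_card (A := [pred v | v \notin S])) => [|v]; last first.
  by rewrite !inE.
by rewrite h; apply: eq_bigr => r _; rewrite [RHS]natn.
Qed.

(** All neighbours of [v] lie in [S] or in the component of [v]; strictness comes from [v]
    itself. *)
Lemma degree_notin_lt v : v \notin S ->
  (degree v < #|S| + #|component (fingraph.root (delete_adj S) v)|)%N.
Proof.
move=> vS; set C := component _.
have vC : v \in C by rewrite inE vS eqxx.
rewrite (cardsD1 v C) vC addnCA ltnS; apply: leq_trans (leq_card_setU _ _).
apply/subset_leq_card/subsetP => u; rewrite !inE => vu.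
case: (boolP (u \in S)) => //= uS.
rewrite (_ : (u != v)) ?(root_connect delete_connect_sym) /=; last first.
  by apply: contraTneq vu => ->; rewrite adj_irr.
by apply: connect1; rewrite /delete_adj /= uS vS adj_sym.
Qed.

(** Vertices in distinct components are not adjacent, so twice the number of missing edges is at
    least the square of [#|~: S|] minus the squares of the component orders. *)
Lemma degree_sum_components :
  (\sum_(v : G) degree v + #|~: S| ^ 2
    <= #|G| * (#|G| - 1) + \sum_(r in component_roots) #|component r| ^ 2)%N.
Proof.
rewrite (bigID (mem S)) /=.
have hS : (\sum_(v in S) degree v <= #|S| * (#|G| - 1))%N.
  rewrite -sum_nat_const; apply: leq_sum => v _.
  by have := degree_lt_card G v; lia.
have hC : (\sum_(v | v \notin S) degree v + #|~: S| <=
    #|~: S| * #|S| + \sum_(r in component_roots) #|component r| ^ 2)%N.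
  have -> : (\sum_(r in component_roots) #|component r| ^ 2 =
    \sum_(v | v \notin S) #|component (fingraph.root (delete_adj S) v)|)%N.
    have := sum_components nat (fun r => #|component r|) => /= ->.
    by apply: eq_bigr => r _; rewrite -mulnn -[RHS]mulr_natr natn.
  have -> : #|~: S| = (\sum_(v | v \notin S) 1)%N.
    by rewrite sum1_card; apply: eq_card => v; rewrite !inE.
  rewrite big_distrl /= -!big_split; apply: leq_sum => v vS /=.
  by rewrite mul1n addn1 degree_notin_lt.
have := cardsC S; rewrite -mulnn.
move: #|S| #|~: S| #|G| hS hC => s N n hS hC sN.
move: hS hC; rewrite -sN.
case: (posnP (s + N)) => [|pos]; first by case: s N sN => [|s] [|N]; lia.
by nia.
Qed.

End Components.

(** * Sums of squares with one dominating part *)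

Lemma sum_sqr_le (I : finType) (P : pred I) (g : I -> nat) :
  (\sum_(i | P i) g i ^ 2 <= (\sum_(i | P i) g i) ^ 2)%N.
Proof.
rewrite -mulnn big_distrl /=; apply: leq_sum => i Pi.
by rewrite -mulnn leq_mul2l (bigD1 i) //= leq_addr orbT.
Qed.

(* For two nonzero parts, (x - 1)(y - 1) >= 0 gives x^2 + y^2 + 2(x + y) <= (x + y)^2 + 2. *)
Lemma sum_sqr_concentrated (I : finType) (A : {set I}) (g : I -> nat) : (0 < #|A|)%N ->
  (exists2 i0, i0 \in A & forall i, i \in A -> i != i0 -> g i = 0%N) \/
  (\sum_(i in A) g i ^ 2 + 2 * \sum_(i in A) g i <= (\sum_(i in A) g i) ^ 2 + 2)%N.
Proof.
case/card_gt0P => j0 j0A.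
case: (boolP [exists i in A, 0 < g i]%N) => [/exists_inP[i iA gi]|/exists_inPn h]; last first.
  by left; exists j0 => // i iA _; apply/eqP; rewrite -leqn0 leqNgt h.
case: (boolP [forall j in A, (j != i) ==> (g j == 0)]%N) => [/forall_inP h|/forall_inPn h].
  by left; exists i => // j jA ji; have := h j jA; rewrite ji => /eqP.
right; case: h => j jA; rewrite negb_imply -lt0n => /andP[ji gj].
rewrite !(bigD1 i iA) /=.
have := sum_sqr_le I (fun k => (k \in A) && (k != i)) g.
have : (0 < \sum_(k in A | k != i) g k)%N by rewrite (bigD1 j) ?jA ?ji //= addn_gt0 gj.
by move: (\sum_(k in A | _) g k)%N (\sum_(k in A | _) g k ^2)%N (g i) gi => x y z; nia.
Qed.

(** * Embedding as a spanning subgraph of the extremal graph *)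

(** Corresponding fibers are enumerated and matched position by position; [y0] is just the default
    of [nth], since every index is in range. *)
Lemma fiber_bijection (A B : finType) (I : eqType) (p : A -> I) (q : B -> I) (y0 : B) :
  #|A| = #|B| -> (forall i, #|[set x | p x == i]| = #|[set y | q y == i]|) ->
  exists2 f : A -> B, bijective f & forall x, q (f x) = p x.
Proof.
move=> cardAB card_fiber.
pose fiber_p i := enum [set x | p x == i]; pose fiber_q i := enum [set y | q y == i].
pose f x := nth y0 (fiber_q (p x)) (index x (fiber_p (p x))).
have index_lt x i : p x = i -> (index x (fiber_p i) < size (fiber_q i))%N.
  by move=> pxi; rewrite -cardE -card_fiber cardE index_mem /fiber_p mem_enum inE pxi.
have qf x : q (f x) = p x.
  have : f x \in fiber_q (p x) := mem_nth y0 (index_lt x _ erefl).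
  by rewrite /fiber_q mem_enum inE => /eqP.
exists f => //; apply: inj_card_bij; last by rewrite cardAB.
move=> x x' ff; have pp : p x = p x' by rewrite -!qf ff.
move/eqP: ff; rewrite /f pp nth_uniq ?enum_uniq ?index_lt // => /eqP.
by apply: (index_inj x); rewrite mem_enum inE ?pp.
Qed.

Lemma superset_card (T : finType) (A B : {set T}) (m : nat) :
  A \subset B -> (#|A| <= m <= #|B|)%N ->
  exists2 C : {set T}, A \subset C /\ C \subset B & #|C| = m.
Proof.
move=> AB /andP[Am mB].
have dAB : #|B :\: A| = (#|B| - #|A|)%N by rewrite cardsD (setIidPr AB).
pose D := [set x in take (m - #|A|) (enum (B :\: A))].
have DB : D \subset B :\: A.
  by apply/subsetP => x; rewrite inE => /mem_take; rewrite mem_enum.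
have cardD : #|D| = (m - #|A|)%N.
  rewrite cardsE (card_uniqP _) ?take_uniq ?enum_uniq // size_takel // -cardE dAB.
  exact: leq_sub2r.
exists (A :|: D); first split; first exact: subsetUl.
  by rewrite subUset AB (subset_trans DB) ?subsetDl.
rewrite cardsU cardD; have -> : A :&: D = set0.
  apply/setP => x; rewrite !inE; apply/negP => /andP[xA xD].
  have /(subsetP DB) : x \in D by rewrite inE.
  by rewrite inE xA.
by rewrite cards0 subn0 subnKC.
Qed.

(** [S] grows, avoiding [T], to a set of [s] vertices sent to K_s; [T] goes to the isolated vertices
    and the rest to K_k. In the target, nonadjacent distinct vertices include an isolated one,
    whereas neighbours of [T] stay in [S]. *)
Lemma clique_star_spanning (G : sgraph) (S T : {set G}) (s k t : nat) :
  (0 < s)%N -> #|G| = (s + k + t)%N -> (#|S| <= s)%N -> #|T| = t -> [disjoint S & T] ->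
  (forall x y, x \in T -> adj x y -> y \in S) ->
  exists2 f : G -> clique_star s k t, bijective f &
    forall x y, adj x y -> adj (f x) (f y).
Proof.
move=> s0 cardG Ss cardT disST nbT.
have ST : S \subset ~: T by rewrite -disjoints_subset.
have [S' [SS' S'T] cardS'] : exists2 C : {set G}, S \subset C /\ C \subset ~: T & #|C| = s.
  by apply: superset_card => //; rewrite Ss; have := cardsC T; lia.
pose p x := if x \in S' then None else Some (x \in T).
pose q (v : clique_star s k t) := match v with
  inl _ => None | inr (inl _) => Some false | inr (inr _) => Some true end.
have cardH : #|clique_star s k t| = (s + k + t)%N.
  by rewrite !card_sum card_prod !card_ord muln1 addnA.
have S'T' x : x \in S' -> x \notin T by move=> /(subsetP S'T); rewrite inE.
have pT x : p x = Some true -> x \in T by rewrite /p; case: ifP => // _ [].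
have card_fiber i : #|[set x | p x == i]| = #|[set y | q y == i]|.
  have -> : #|[set y | q y == i]| =
     match i with None => s | Some false => k | Some true => t end.
    rewrite -sum1dep_card !big_sumType /=.
    by case: i => [[]|]; rewrite ?big_pred0_eq ?sum1_card ?card_prod ?card_ord ?muln1 ?addn0 ?add0n.
  have eT : #|[set x | p x == Some true]| = t.
    rewrite -cardT; apply: eq_card => x; rewrite !inE /p.
    by case: ifP => [/S'T' /negPf ->|_] //; case: (x \in T).
  have eS : #|[set x | p x == None]| = s.
    by rewrite -cardS'; apply: eq_card => x; rewrite !inE /p; case: ifP.
  case: i => [[]|] //.
  have := cardC (S' :|: T); rewrite cardsU cardS' cardT (_ : S' :&: T = set0); last first.
    by apply/setP => x; rewrite !inE; apply/negP => /andP[/S'T' /negPf ->].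
  rewrite cards0 (eq_card (A := [predC _]) (B := [set x | p x == Some false])).
    by rewrite cardG subn0 addnAC => /addIn/addnI.
  by move=> x; rewrite !inE /p; case: (x \in S') => //; case: (x \in T).
have [f fbij qf] := fiber_bijection _ _ _ p q (inl (Ordinal s0))
  (etrans cardG (esym cardH)) card_fiber.
exists f => // x y xy.
have fxy : f x != f y.
  by rewrite (bij_eq fbij); apply: contraTneq xy => ->; rewrite adj_irr.
have nT u v : adj u v -> q (f u) = Some true -> q (f v) = None.
  rewrite !qf => uv /pT uT; rewrite /p.
  by rewrite (subsetP SS' _ (nbT _ _ uT uv)).
have := nT _ _ xy; have := nT y x; rewrite adj_sym xy => /(_ isT).
move: (f x) (f y) fxy => [i|[i|i]] [j|[j|j]] //= ij.
- by move=> /(_ erefl).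
- by move=> _ /(_ erefl).
- by move=> _ /(_ erefl).
Qed.

(** * Inequalities drawn from the lower bounds on the order *)

(** Divided by b + 1, the conclusion reads C - 1 >= 2(b + 1)(l - 1) for C = (n + 1)/(b + 1), the
    solution of n - b C + 1 = C. *)
Lemma order_lower_bound (R : realFieldType) (b l n : R) : 1 <= b -> 2 <= l ->
  (5 / 2 * b ^+ 2 + 4 * b + 3) * l - b ^+ 2 - 2 * b - 5 <= n ->
  2 * (b + 1) ^+ 2 * (l - 1) <= n - b.
Proof.
move=> b1 l2 n_ge1.
have b2 : 1 <= b ^+ 2 by rewrite exprn_ege1.
have h1 : 0 <= b ^+ 2 / 2 + 1 by lra.
have h2 : 0 <= l - 2 by lra.
by have := mulr_ge0 h1 h2; lra.
Qed.

(** Ensures that the natural subtraction in the clique order n - (b + 1) l + 2 is not truncated. *)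
Lemma order_ge_clique_star (R : realFieldType) (b l n : R) : 1 <= b -> 2 <= l ->
  2 * (b + 1) ^+ 2 * (l - 1) <= n - b -> (b + 1) * l <= n.
Proof.
move=> b1 l2 lb.
have h1 : 0 <= b + 1 by lra.
have h2 : 0 <= 2 * (b + 1) * (l - 1) - l.
  have h3 : 0 <= b - 1 by lra.
  have h4 : 0 <= l - 1 by lra.
  by have := mulr_ge0 h3 h4; lra.
by have := mulr_ge0 h1 h2; lra.
Qed.

(* The right-hand side is twice the number of edges missing when c - 1 of the
   c components of the N vertices outside S are singletons; for N = n - b c + 1
   it is concave in c, so only the extreme values of c matter. *)
Lemma missing_edges_many_components (R : realFieldType) (b l n c N : R) :
  1 <= b -> 2 <= l ->
  2 * (b + 1) ^+ 2 * (l - 1) <= n - b ->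
  ((2 * b + 1) * l ^+ 2 + (2 * b - 3) * l + 2) / 2 <= n ->
  l + 1 <= c -> c <= N -> n - b * c + 1 <= N ->
  2 * (n - 1) * (l - 1) <= (c - 1) * (2 * N - c).
Proof.
move=> b1 l2 lb n_ge2 lc cN nN.
have b0 : 0 < b + 1 by lra.
have l0 : 0 <= l - 1 by lra.
have c0 : 0 <= c - 1 by lra.
have bl0 : 0 <= 2 * (b + 1) * (l - 1) by rewrite mulr_ge0 // mulr_ge0 // ltW.
have large C : n + 1 <= (b + 1) * C ->
    2 * (b + 1) * (l - 1) <= C - 1 /\ 2 * (n - 1) * (l - 1) <= (C - 1) * C.
  move=> hC; have h1 : 2 * (b + 1) * (l - 1) <= C - 1.
    by rewrite -(ler_pM2l b0); lra.
  split=> //; have h2 : 0 <= C - 1 - 2 * (b + 1) * (l - 1) by lra.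
  have h3 : 0 <= C by lra.
  have h4 : 0 <= (b + 1) * C - (n + 1) by lra.
  by have := mulr_ge0 h2 h3; have := mulr_ge0 h4 l0; lra.
(* For c >= C the bound N >= c suffices, as then 2 N - c >= c. *)
case: (lerP (n + 1) ((b + 1) * c)) => hc.
  by apply: le_trans (large c hc).2 _; rewrite ler_wpM2l //; lra.
have {}nN : 0 <= N - (n - b * c + 1) by lra.
suff : 2 * (n - 1) * (l - 1) <= (c - 1) * (2 * (n - b * c + 1) - c).
  by have := mulr_ge0 c0 nN; lra.
(* The product of [h1] and [h2] is the value at c minus the value at l + 1, and the claim at l + 1
   is exactly the second lower bound on n. *)
case: (lerP ((2 * b + 1) * (c + l)) (2 * n + 2)) => hcl.
  have h1 : 0 <= c - l - 1 by lra.
  have h2 : 0 <= 2 * n + 2 - (2 * b + 1) * (c + l) by lra.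
  by have := mulr_ge0 h1 h2; lra.
(* Otherwise the value at c is at least the one at C, which is (C - 1) C; their difference is the
   product of [h3] and [h4]. *)
pose C := (n + 1) / (b + 1).
have Cn : (b + 1) * C = n + 1 by rewrite mulrC divfK // gt_eqF.
have [|C1 C2] := large C; first by rewrite Cn.
apply: le_trans C2 _.
have cC : c <= C by rewrite -(ler_pM2l b0) Cn ltW.
have Cl : 0 <= C - 1 - l.
  have h1 : 0 <= b - 1 by lra.
  by have := mulr_ge0 h1 l0; lra.
have h2 : 0 <= 2 * b + 1 by lra.
have h3 : 0 <= C - c by lra.
have h4 : 0 <= (2 * b + 1) * (c + C - 1) - (2 * n + 2) by have := mulr_ge0 h2 Cl; lra.
have := mulr_ge0 h3 h4; have -> : n = (b + 1) * C - 1 by rewrite Cn addrK.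
by lra.
Qed.

(** The right-hand side is twice the number of edges missing between components of orders N - l, 2
    and l - 2 times 1, the extreme case with two nontrivial components. *)
Lemma missing_edges_two_large_components (R : realFieldType) (b l n N : R) :
  1 <= b -> 2 <= l ->
  ((2 * b + 1) * l ^+ 2 + (2 * b - 3) * l + 2) / 2 <= n -> n - b * l + 1 <= N ->
  2 * (n - 1) * (l - 1) <= (l - 1) * (2 * N - l) + 2 * (N - l) - 2.
Proof.
move=> b1 l2 n_ge2 nN.
have h1 : 0 <= N - (n - b * l + 1) by lra.
have h2 : 0 <= l by lra.
have h3 : 0 <= b - 1 by lra.
by have := mulr_ge0 h1 h2; have := mulr_ge0 h3 h2; lra.
Qed.


(** * From a violating cut to the extremal graph *)

Lemma toughness_ge_or_cut (R : realType) (G : sgraph) (b l : nat) : (0 < l)%N ->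
  (b%:R%:E <= toughness G R l)%E \/
  exists2 S : {set G}, (l <= ncomp_delete S)%N & (#|S| < b * ncomp_delete S)%N.
Proof.
move=> l0; case: (boolP [exists S : {set G},
    (l <= ncomp_delete S) && (#|S| < b * ncomp_delete S)]%N).
  by move=> /existsP[S /andP[lS Sb]]; right; exists S.
(* Both the value for l above the independence number and the default of the minimum are [+oo]. *)
move=> /existsPn noS; left; rewrite /toughness; case: ifP => _; last exact: leey.
apply: le_bigmin => [|S lS]; first exact: leey.
rewrite lee_fin ler_pdivlMr ?ltr0n ?(leq_trans l0) // -natrM ler_nat leqNgt.
by have := noS S; rewrite lS.
Qed.

Lemma eigenvalue_clique_star (R : realType) (s k t : nat) (r : R)
    (w : clique_star s k t -> R) : (0 < s)%N -> (forall v, 0 < w v) ->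
  (forall v, \sum_(u | adj v u) (w v + w u) = r * w v) ->
  eigenvalue (signless_laplacian R (clique_star s k t)) r.
Proof.
move=> s0 w0 wr; apply/eigenvalue_eigenfunction; exists w => //.
by exists (inl (Ordinal s0)); rewrite gt_eqF.
Qed.

(* With N vertices outside S and c components of G - S, the hypothesis on D says
   that fewer than (n - 1)(l - 1) edges are missing from G. *)
Lemma cut_of_dense_graph (R : realFieldType) (G : sgraph) (S : {set G}) (b l n : nat) :
  (1 <= b)%N -> (2 <= l)%N -> #|G| = n ->
  2 * (b%:R + 1) ^+ 2 * (l%:R - 1) <= n%:R - b%:R :> R ->
  ((2 * b%:R + 1) * l%:R ^+ 2 + (2 * b%:R - 3) * l%:R + 2) / 2 <= n%:R :> R ->
  (l <= ncomp_delete S)%N -> (#|S| < b * ncomp_delete S)%N ->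
  (n%:R - 1) * (n%:R - 2 * l%:R + 2) < (\sum_(v : G) degree v)%:R :> R ->
  ncomp_delete S = l /\ exists2 r0, r0 \in component_roots G S &
    forall r, r \in component_roots G S -> r != r0 -> #|component G S r| = 1%N.
Proof.
move=> hb hl cardG lb n_ge2 lc Sb; have := degree_sum_components G S.
rewrite ncomp_delete_card in lc Sb *; move: Sb lc.
set K := component_roots G S; set c := #|K| => Sb lc.
(* [g] counts the vertices of a component beyond the first. Below, [E] is its sum and [Q] its sum of
   squares, so [S] has E + c vertices outside it. *)
pose g r := (#|component G S r| - 1)%N.
have gE r : r \in K -> #|component G S r| = (g r + 1)%N.
  move=> rK; rewrite subnK //; apply/card_gt0P; exists r; exact: root_mem_component.
have sumE : (\sum_(r in K) g r + c = #|~: S|)%N.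
  rewrite -sum_card_components /c -sum1_card -big_split /=.
  by apply: eq_bigr => r rK; rewrite -gE.
have sqE : (\sum_(r in K) #|component G S r| ^ 2 =
    \sum_(r in K) g r ^ 2 + 2 * \sum_(r in K) g r + c)%N.
  rewrite /c -sum1_card big_distrr /= -!big_split /=.
  by apply: eq_bigr => r rK; rewrite gE // -!mulnn; ring.
have nSN : (#|S| + #|~: S| = n)%N by rewrite cardsC cardG.
have c0 : (0 < c)%N by rewrite (leq_trans _ lc) // ltnW.
have := sum_sqr_le G (mem K) g; have := sum_sqr_concentrated G K g c0.
rewrite sqE cardG -sumE; rewrite -sumE in nSN; move: nSN Sb; rewrite /=.
move: (\sum_(v : G) degree v)%N (\sum_(r in K) g r ^ 2)%N (\sum_(r in K) g r)%N
   => D Q E nSN Sb conc QE Dn DR.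
have [b1 l2] : 1 <= b%:R :> R /\ 2 <= l%:R :> R by rewrite ler1n ler_nat.
have {}Sb : n%:R - b%:R * c%:R + 1 <= E%:R + c%:R :> R.
  suff : (n + 1 <= E + c + b * c)%N by rewrite -(ler_nat R) !natrD natrM; lra.
  by lia.
have {}Dn : D%:R + (E%:R + c%:R) ^+ 2 <= n%:R * (n%:R - 1) + (Q%:R + 2 * E%:R + c%:R) :> R.
  move: Dn; rewrite -(ler_nat R) !natrD natrX natrM natrD natrB; last by lia.
  by lra.
have {}QE : Q%:R <= E%:R ^+ 2 :> R by move: QE; rewrite -(ler_nat R) natrX.
have cl : c = l.
  apply/eqP; rewrite eqn_leq lc andbT leqNgt; apply/negP => lc'.
  have {}lc' : l%:R + 1 <= c%:R :> R by rewrite natr1 ler_nat.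
  have cN : c%:R <= E%:R + c%:R :> R by rewrite lerDr ler0n.
  (* Since Q <= E^2, [Dn] leaves at least (c - 1)(2 N - c) for twice the missing edges, with N = E +
     c. *)
  have := missing_edges_many_components _ _ _ _ _ _ b1 l2 lb n_ge2 lc' cN Sb.
  by lra.
split=> //; case: conc => [[r0 r0K h]|conc].
  by exists r0 => // r rK rr0; rewrite gE // h.
have {}conc : Q%:R + 2 * E%:R <= E%:R ^+ 2 + 2 :> R.
  by move: conc; rewrite -(ler_nat R) !natrD natrX; lra.
rewrite cl in Sb Dn.
have := missing_edges_two_large_components _ _ _ _ _ b1 l2 n_ge2 Sb.
by lra.
Qed.

Theorem theorem1p1 (R : realType) (b l n : nat) (G : sgraph)
    (hb : (1 <= b)%N) (hl : (2 <= l)%N)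
    (hconn : graph_connected G) (horder : #|G| = n)
    (hn : Num.max
            ((5 / 2 * b%:R ^+ 2 + 4 * b%:R + 3) * l%:R
               - b%:R ^+ 2 - 2 * b%:R - 5)
            (((2 * b%:R + 1) * l%:R ^+ 2 + (2 * b%:R - 3) * l%:R + 2) / 2)
          <= n%:R :> R)
    (hq : Qindex R (extremal_graph b l n) <= Qindex R G) :
  (b%:R%:E <= toughness G R l)%E \/ graph_isomorphic G (extremal_graph b l n).
Proof.
case: (toughness_ge_or_cut R G b l (ltnW hl)) => [|[S lc Sb]]; first by left.
right; move: hn; rewrite ge_max => /andP[n_ge1 n_ge2].
have [b1 l2] : 1 <= b%:R :> R /\ 2 <= l%:R :> R by rewrite ler1n ler_nat.
have lb := order_lower_bound _ _ _ _ b1 l2 n_ge1.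
have nl : ((b + 1) * l <= n)%N.
  by rewrite -(ler_nat R) natrM natrD; have := order_ge_clique_star _ _ _ _ b1 l2 lb; lra.
have bl : (2 <= b * l)%N by rewrite -[2%N]mul1n leq_mul.
have n1 : (1 < n)%N by lia.
pose k := (n - (b + 1) * l + 2)%N.
have s0 : (0 < b * l - 1)%N by lia.
have k0 : (0 < k)%N by rewrite /k addn2.
have t0 : (0 < l - 1)%N by lia.
have skn : (b * l - 1 + k + (l - 1))%N = n by rewrite /k; lia.
have [r r_gt [w w0 wr]] := clique_star_eigenfunction R _ _ _ s0 k0 t0.
(* The two cliques together have n - l + 1 vertices. *)
have {}r_gt : 2 * (n%:R - l%:R) < r.
  have : (b * l - 1 + k)%:R = n%:R - l%:R + 1 :> R.
    by rewrite -natrB ?natr1; [congr _%:R|]; lia.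
  by rewrite natrD; lra.
have rq : r <= Qindex R G.
  apply: le_trans hq; apply: eigenvalue_le_Qindex.
  exact: eigenvalue_clique_star s0 w0 wr.
have qev : eigenvalue (signless_laplacian R G) (Qindex R G).
  apply: Qindex_eigenvalue; apply: lt_le_trans rq; apply: le_lt_trans r_gt.
  by rewrite mulr_ge0 // subr_ge0 ler_nat; lia.
have D_gt : (n%:R - 1) * (n%:R - 2 * l%:R + 2) < (\sum_(v : G) degree v)%:R :> R.
  have := eigenvalue_le_degree_sum R G _ hconn _ qev; rewrite horder => /(_ n1) qD.
  have nR : 0 < n%:R - 1 :> R by rewrite subr_gt0 ltr1n.
  by rewrite mulrC -ltr_pdivlMr //; lra.
have [cl [r0 r0K comp1]] := cut_of_dense_graph R G S b l n hb hl horder lb n_ge2 lc Sb D_gt.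
(* The other components are singletons, so their roots are all their vertices. *)
pose T := component_roots G S :\ r0.
have [f fbij fhom] : exists2 f : G -> clique_star (b * l - 1) k (l - 1),
    bijective f & forall x y, adj x y -> adj (f x) (f y).
  apply: (clique_star_spanning G S T) => //.
  - by rewrite horder skn.
  - by rewrite -ltnS subn1 prednK -?cl // cl ltnW.
  - by rewrite -cl ncomp_delete_card (cardsD1 r0 (component_roots G S)) r0K addKn.
  - rewrite disjoint_sym disjoints_subset; apply/subsetP => x.
    by rewrite !inE => /and3P[].
  move=> x y; rewrite in_setD1 => /andP[xr0 xK] xy; apply: contraT => yS.
  have := xK; rewrite inE => /andP[xS xroot].
  have /eqP/cards1P[z Cz] := comp1 x xK xr0.
  have : x \in component G S x by exact: root_mem_component.
  have : y \in component G S x.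
    rewrite inE yS /= -[X in _ == X](eqP xroot) (root_connect (delete_connect_sym G S)).
    by apply: connect1; rewrite /delete_adj /= yS xS adj_sym.
  by rewrite Cz => /set1P yz /set1P xz; rewrite xz yz adj_irr in xy.
(* With [rq], this squeezes the Q-index of [G] to [r], the case of equality. *)
have [qr iso] := spanning_subgraph_eigenvalue R G _ f w r _ fbij fhom w0 wr qev.
by apply: iso => //; apply/eqP; rewrite eq_le qr.
Qed.
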